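(* Let $(X,\|\cdot\|)$ be a normed space, $C\subseteq X$ a convex set with finite diameter $\operatorname{diam}(C)\le\kappa$, and $T:C\to C$ an $\ell$-Lipschitz map with $\ell\in(0,1]$. Let $\alpha\in(0,1]$, and let $(x_m)_{m\ge 0}$ be generated from $x_0\in C$ by $x_{m+1}=(1-\alpha)x_m+\alpha\,Tx_m$ for all integers $m\ge 0$. Then for all integers $0\le m\le n$ we have $\|x_m-x_n\|\le\kappa\,c_{m,n}$ and $\|x_m-Tx_m\|\le\kappa\,c_{m,m+1}/\alpha$, where $$c_{m,n}=\alpha\sum_{j=0}^{n-1}\sum_{k=0}^{m}L^{k,j}_{m,n}\,(\alpha^2\ell)^k(1-\alpha)^{n+m-1-j-2k},$$ $$L^{k,j}_{m,n}=\binom{m}{k}\binom{n-1-j}{k}-\binom{n}{k}\binom{m-1-j}{k}.$$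
   Context: Convention for binomials: $\binom{a}{k}=0$ if $k$ is not in the range $0\le k\le a$ (in particular if $a<0\le k$), and $\binom{0}{0}=1$. Also $0^0=1$. With this convention the inner sum over $k$ is restricted to $0\le k\le\min\{m,n-1-j\}$ (the coefficients $L^{k,j}_{m,n}$ vanish for larger $k$ and those terms are taken to be $0$), so no negative powers of $1-\alpha$ appear. *)

(* Defs.v *)
From HB Require Import structures.
From mathcomp Require Import all_boot all_order all_algebra.
From mathcomp Require Import all_classical all_reals all_analysis.

Set Implicit Arguments.
Unset Strict Implicit.
Unset Printing Implicit Defensive.

Import Order.TTheory GRing.Theory Num.Theory.
Import numFieldNormedType.Exports.

Local Open Scope classical_set_scope.
Local Open Scope ring_scope.

(* Extended-real valued: it is +oo when C is unbounded and -oo when C = set0. *)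
Definition diam (R : realType) (X : normedModType R) (C : set X) : \bar R :=
  ereal_sup [set `|x - y|%:E | x in C & y in C].

(* The upper argument is an integer, and the value is 0 unless 0 <= k <= a:
   truncated subtraction on nat would give 'C(0, 0) = 1 for the upper
   argument m - 1 - j when j >= m. *)
Definition binz (a : int) (k : nat) : int :=
  if a is Posz n then Posz 'C(n, k) else 0.

Definition L (m n k j : nat) : int :=
  binz m%:Z k * binz (n%:Z - 1 - j%:Z) k
  - binz n%:Z k * binz (m%:Z - 1 - j%:Z) k.

(* The exponent of 1 - alpha is an integer. For m <= n and j < n it can only be
   negative when k > minn m (n - 1 - j); then L m n k j = 0 and, inverses being
   total, so is the whole term. *)
Definition c (R : realType) (alpha ell : R) (m n : nat) : R :=
  alpha * \sum_(0 <= j < n) \sum_(0 <= k < m.+1)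
    (L m n k j)%:~R * (alpha ^+ 2 * ell) ^+ k
    * (1 - alpha) ^ (n%:Z + m%:Z - 1 - j%:Z - 2 * k%:Z).

(* Main.v *)
(* For m <= n put a(m, n) = |x_m - x_n| and b(m, n) = |x_m - T x_n|. Expanding
   the last step of the iteration gives
     a(m, n + 1) <= (1 - alpha) a(m, n) + alpha b(m, n),
     b(m + 1, n) <= (1 - alpha) b(m, n) + alpha ell a(m, n),
   with a(m, m) = 0 and b(0, n) <= kappa. As the coefficients are nonnegative,
   a is bounded by kappa times the solution of the recurrence obtained by
   eliminating b. That solution is c: with D(m, n) =
   sum_k C(m, k) C(n, k) (alpha^2 ell)^k (1 - alpha)^(m + n - 2 k), one has
     c(m, n) = alpha (sum_(i < n) D(m, i) - sum_(i < m) D(n, i)),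
   and D is a weighted Delannoy array, which satisfies the same three-term
   recurrence. *)
Require Import Defs.
From HB Require Import structures.
From mathcomp Require Import all_boot all_order all_algebra.
From mathcomp Require Import all_classical all_reals all_analysis.
From mathcomp Require Import ring zify.

Set Implicit Arguments.
Unset Strict Implicit.
Unset Printing Implicit Defensive.

Import Order.TTheory GRing.Theory Num.Theory.
Import numFieldNormedType.Exports.

Local Open Scope classical_set_scope.
Local Open Scope ring_scope.

Definition delannoy_coef (R : comNzRingType) (b : R) (m k : nat) : R :=
  'C(m, k)%:R * b ^+ (m - k).

(* The total weight of the lattice paths from (0, 0) to (m, n) with steps (1, 0)
   and (0, 1) of weight b and (1, 1) of weight p - b ^+ 2. *)
Definition delannoy (R : comNzRingType) (b p : R) (m n : nat) : R :=
  \sum_(0 <= k < m.+1) delannoy_coef b m k * delannoy_coef b n k * p ^+ k.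

Definition delannoy_sum (R : comNzRingType) (b p : R) (m n : nat) : R :=
  \sum_(0 <= i < n) delannoy b p m i.

Section Delannoy.
Variables (R : comNzRingType) (b p : R).
Implicit Types m n k : nat.

Lemma delannoy_coef0 m : delannoy_coef b m 0 = b ^+ m.
Proof. by rewrite /delannoy_coef bin0 subn0 mul1r. Qed.

Lemma delannoy_coef_small m k : (m < k)%N -> delannoy_coef b m k = 0.
Proof. by move=> mk; rewrite /delannoy_coef bin_small// mul0r. Qed.

Lemma delannoy_coefSS m k : delannoy_coef b m.+1 k.+1 =
  b * delannoy_coef b m k.+1 + delannoy_coef b m k.
Proof.
rewrite /delannoy_coef binS natrD mulrDl subSS; congr (_ + _).
have [km|mk] := ltnP k m; last by rewrite bin_small// !mul0r mulr0.
by rewrite -subSS subSn// exprS mulrCA.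
Qed.

Lemma delannoy_widen N m n : (m < N)%N -> delannoy b p m n =
  \sum_(0 <= k < N) delannoy_coef b m k * delannoy_coef b n k * p ^+ k.
Proof.
move=> mN; rewrite /delannoy (big_cat_nat (n := m.+1) (p := N))//=.
rewrite [X in _ = _ + X]big_nat [X in _ = _ + X]big1 ?addr0// => k /andP[mk _].
by rewrite delannoy_coef_small// !mul0r.
Qed.

Lemma delannoyC m n : delannoy b p m n = delannoy b p n m.
Proof.
rewrite (@delannoy_widen (maxn m n).+1) ?ltnS ?leq_maxl//.
rewrite (@delannoy_widen (maxn m n).+1 n) ?ltnS ?leq_maxr//.
by apply: eq_bigr => k _; congr (_ * _); rewrite mulrC.
Qed.

Lemma delannoyn0 m : delannoy b p m 0 = b ^+ m.
Proof.
by rewrite delannoyC /delannoy big_nat1 !delannoy_coef0 !expr0 mul1r mulr1.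
Qed.

(** Multiply the Pascal rules [delannoy_coefSS] for [m] and [n]. The first two terms on the right
    cover all products with a factor [b], but count the one with [b ^+ 2] twice; the remaining
    product gives [p]. *)
Lemma delannoySS m n : delannoy b p m.+1 n.+1 =
  b * delannoy b p m n.+1 + b * delannoy b p m.+1 n
  + (p - b ^+ 2) * delannoy b p m n.
Proof.
rewrite mulrBl [p * _]mulr_sumr.
rewrite (@delannoy_widen m.+2 m.+1) ?(@delannoy_widen m.+2 m)//.
rewrite (@delannoy_widen m.+2 m.+1)// !mulr_sumr.
rewrite big_nat_recl// [in RHS]big_nat_recl// [X in _ + X + _]big_nat_recl//.
rewrite [X in _ - X]big_nat_recl//.
rewrite (eq_bigr (fun k =>
    b * (delannoy_coef b m k.+1 * delannoy_coef b n.+1 k.+1 * p ^+ k.+1)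
    + b * (delannoy_coef b m.+1 k.+1 * delannoy_coef b n k.+1 * p ^+ k.+1)
    + p * (delannoy_coef b m k * delannoy_coef b n k * p ^+ k)
    - b ^+ 2 * (delannoy_coef b m k.+1 * delannoy_coef b n k.+1 * p ^+ k.+1))).
  rewrite sumrB !big_split/= !delannoy_coef0 !exprS.
  by ring.
by move=> k _; rewrite !delannoy_coefSS exprS; ring.
Qed.

(** Sum [delannoySS] over the second index; the boundary terms at index 0 agree since
    [b ^+ m.+1 = b * b ^+ m]. *)
Lemma delannoy_sumSS m n : delannoy_sum b p m.+1 n.+1 =
  b * delannoy_sum b p m n.+1 + b * delannoy_sum b p m.+1 n
  + (p - b ^+ 2) * delannoy_sum b p m n.
Proof.
rewrite /delannoy_sum big_nat_recl// [X in b * X + _]big_nat_recl//.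
under eq_bigr do rewrite delannoySS.
by rewrite !big_split/= -!mulr_sumr !delannoyn0 exprS; ring.
Qed.

End Delannoy.

(** This covers [b = 0] too: the integer exponent is nonnegative whenever both binomials are
    nonzero. *)
Lemma binz_delannoy (F : fieldType) (b : F) (m n k : nat) :
  (binz m%:Z k * binz n%:Z k)%:~R * b ^ (m%:Z + n%:Z - 2 * k%:Z) =
  delannoy_coef b m k * delannoy_coef b n k.
Proof.
rewrite /binz /delannoy_coef.
have [km|mk] := leqP k m; last by rewrite bin_small// !mul0r.
have [kn|nk] := leqP k n; last by rewrite (bin_small nk) mulr0 !mul0r mulr0.
have -> : m%:Z + n%:Z - 2 * k%:Z = ((m - k) + (n - k))%N :> int by lia.
by rewrite -exprnP exprD rmorphM/= mulrACA.
Qed.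

Lemma sum_binz_delannoy (F : fieldType) (b p : F) (m n N : nat) : (m < N)%N ->
  \sum_(0 <= k < N) (binz m%:Z k * binz n%:Z k)%:~R * p ^+ k
    * b ^ (m%:Z + n%:Z - 2 * k%:Z) = delannoy b p m n.
Proof.
move=> mN; rewrite (delannoy_widen _ _ _ mN).
by apply: eq_bigr => k _; rewrite mulrAC binz_delannoy.
Qed.

Lemma cE (R : realType) (alpha ell : R) (m n : nat) : (m <= n)%N ->
  c alpha ell m n =
    alpha * (delannoy_sum (1 - alpha) (alpha ^+ 2 * ell) m n
             - delannoy_sum (1 - alpha) (alpha ^+ 2 * ell) n m).
Proof.
move=> mn; rewrite /c; congr (_ * _).
set b := 1 - alpha; set p := alpha ^+ 2 * ell.
have -> : delannoy_sum b p m n = \sum_(0 <= j < n) delannoy b p m (n - j.+1).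
  by rewrite /delannoy_sum big_nat_rev.
(* Padding with zeros lets both sums run over the [j] of [c]; for [j >= m] the zero matches [binz]
   at a negative argument. *)
have -> : delannoy_sum b p n m =
    \sum_(0 <= j < n) if (j < m)%N then delannoy b p n (m - j.+1) else 0.
  by rewrite -big_mkcond /delannoy_sum big_nat_rev/= (big_nat_widen _ _ n).
rewrite -sumrB; apply: eq_big_nat => j /andP[_ jn].
pose t (u v : int) k := (binz u k * binz v k)%:~R * p ^+ k
  * b ^ (u + v - 2 * k%:Z).
transitivity (\sum_(0 <= k < m.+1) t m (n - j.+1)%N k
    - \sum_(0 <= k < m.+1) t n (m%:Z - 1 - j%:Z) k).
  rewrite -sumrB; apply: eq_bigr => k _; rewrite /t /L.
  have -> : n%:Z - 1 - j%:Z = (n - j.+1)%N by lia.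
  have -> : n%:Z + m%:Z - 1 - j%:Z - 2 * k%:Z
    = m%:Z + (n - j.+1)%N%:Z - 2 * k%:Z by lia.
  have -> : n%:Z + (m%:Z - 1 - j%:Z) - 2 * k%:Z
    = m%:Z + (n - j.+1)%N%:Z - 2 * k%:Z by lia.
  by rewrite rmorphB/= -!mulrBl.
rewrite sum_binz_delannoy//; congr (_ - _).
case: ifPn => jm.
  have -> : m%:Z - 1 - j%:Z = (m - j.+1)%N by lia.
  (* By symmetry the smaller index [m - j.+1] bounds [k], so the range [k < m.+1] of [c]
     suffices. *)
  rewrite delannoyC -(@sum_binz_delannoy _ _ _ _ _ m.+1) ?ltnS ?leq_subr//.
  apply: eq_bigr => k _.
  by rewrite /t [X in _ ^ (X - _)]addrC [X in X%:~R]mulrC.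
rewrite big1// => k _; rewrite /t.
suff -> : binz (m%:Z - 1 - j%:Z) k = 0 by rewrite mulr0 !mul0r.
have : m%:Z - 1 - j%:Z < 0 by lia.
by case: (_ - j%:Z).
Qed.

Lemma cmm (R : realType) (alpha ell : R) (m : nat) : c alpha ell m m = 0.
Proof. by rewrite cE// subrr mulr0. Qed.

(** The recurrence is symmetric in the two indices, so both sums in [cE] obey it; [m < n] makes [cE]
    available at [(m.+1, n)]. *)
Lemma cSS (R : realType) (alpha ell : R) (m n : nat) : (m < n)%N ->
  c alpha ell m.+1 n.+1 =
    (1 - alpha) * c alpha ell m n.+1 + (1 - alpha) * c alpha ell m.+1 n
    + (alpha ^+ 2 * ell - (1 - alpha) ^+ 2) * c alpha ell m n.
Proof. by move=> mn; rewrite !cE ?delannoy_sumSS; [ring|lia..]. Qed.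

Lemma c0S (R : realType) (alpha ell : R) (n : nat) :
  c alpha ell 0 n.+1 = (1 - alpha) * c alpha ell 0 n + alpha.
Proof.
rewrite !cE// /delannoy_sum !(big_geq (leqnn 0)) !subr0 big_nat_recl//.
rewrite delannoyn0 expr0.
have E j : delannoy (1 - alpha) (alpha ^+ 2 * ell) 0 j = (1 - alpha) ^+ j.
  by rewrite delannoyC delannoyn0.
under eq_bigr do rewrite E exprS.
by under [in RHS]eq_bigr do rewrite E; rewrite -mulr_sumr; ring.
Qed.

Lemma diam_ub (R : realType) (X : normedModType R) (C : set X) (r : R)
    (y z : X) :
  (diam C <= r%:E)%E -> C y -> C z -> `|y - z| <= r.
Proof.
move=> Cr Cy Cz; rewrite -lee_fin; apply: le_trans Cr.
by apply: ereal_sup_ubound; exists y => //; exists z.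
Qed.

Lemma convex_set_comb (R : realType) (X : normedModType R) (C : set X)
    (t : R) (y z : X) :
  convex_set (C : set (convex_lmodType X)) -> 0 <= t -> t <= 1 ->
  C y -> C z -> C ((1 - t) *: y + t *: z).
Proof.
(* [conv] puts the weight [t] on its first point, hence the order [z y]. *)
move=> C_convex t0 t1 Cy Cz; have := C_convex z y (Itv01 t0 t1).
by rewrite !inE => /(_ Cz Cy); rewrite [conv _ _ _]addrC.
Qed.

Theorem theorem1 (R : realType) (X : normedModType R) (C : set X)
    (kappa ell alpha : R) (T : {fun C >-> C}) (x : nat -> X)
    (C_convex : convex_set (C : set (convex_lmodType X)))
    (C_diam : (diam C <= kappa%:E)%E)
    (ell_gt0 : 0 < ell) (ell_le1 : ell <= 1)
    (T_lip : ell.-lipschitz_C T)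
    (alpha_gt0 : 0 < alpha) (alpha_le1 : alpha <= 1)
    (x0C : C (x 0%N))
    (xS : forall m : nat, x m.+1 = (1 - alpha) *: x m + alpha *: T (x m)) :
  forall m n : nat, (m <= n)%N ->
    `|x m - x n| <= kappa * c alpha ell m n /\
    `|x m - T (x m)| <= kappa * c alpha ell m m.+1 / alpha.
Proof.
have xC m : C (x m).
  elim: m => [//|m IH]; rewrite xS; apply: convex_set_comb => //.
    exact: ltW.
  exact: (@funS _ _ _ _ T).
have TxC m : C (T (x m)) by exact: (@funS _ _ _ _ T).
have b0 : 0 <= 1 - alpha by rewrite subr_ge0.
have dist_comb (u v w : X) : `|w - ((1 - alpha) *: u + alpha *: v)|
    <= (1 - alpha) * `|w - u| + alpha * `|w - v|.
  have -> : w - ((1 - alpha) *: u + alpha *: v)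
      = (1 - alpha) *: (w - u) + alpha *: (w - v).
    by rewrite !scalerBr addrACA -scalerDl subrK scale1r opprD.
  by rewrite (le_trans (ler_normD _ _))// !normrZ !ger0_norm// ltW.
(* [kappa * e m n] is to bound b(m, n): [e] is solved from the first recurrence taken with
   equality. *)
pose e m n := (c alpha ell m n.+1 - (1 - alpha) * c alpha ell m n) / alpha.
have ce m n :
    c alpha ell m n.+1 = (1 - alpha) * c alpha ell m n + alpha * e m n.
  by rewrite /e [alpha * _]mulrC divfK ?gt_eqF// addrC subrK.
(* For fixed [m], bounds on b give bounds on a, by induction on [n - m] from
   [c alpha ell m m = 0]. *)
have xTx m : (forall n, (m <= n)%N -> `|x m - T (x n)| <= kappa * e m n) ->
    forall n, (m <= n)%N -> `|x m - x n| <= kappa * c alpha ell m n.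
  move=> H n /subnKC<-; elim: (n - m)%N => [|d IH].
    by rewrite addn0 cmm mulr0 subrr normr0.
  rewrite addnS xS (le_trans (dist_comb _ _ _))// ce mulrDr.
  rewrite (mulrCA kappa (1 - alpha)) (mulrCA kappa alpha (e _ _)).
  by rewrite lerD ?ler_wpM2l ?H ?leq_addr// ltW.
have main m n : (m <= n)%N -> `|x m - T (x n)| <= kappa * e m n.
  elim: m n => [|m IH] n mn.
    (* By [c0S], [e 0 n = 1], so the diameter bound is the base case. *)
    by rewrite /e c0S addrAC subrr add0r divff ?gt_eqF// mulr1 (diam_ub C_diam).
  (* This is the second recurrence with equality, equivalent to [cSS] once [e] is unfolded. *)
  have -> : e m.+1 n = (1 - alpha) * e m n + alpha * (ell * c alpha ell m n).
    by rewrite /e cSS//; field; rewrite gt_eqF.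
  rewrite xS distrC (le_trans (dist_comb _ _ _))// mulrDr.
  rewrite (mulrCA kappa (1 - alpha)) (mulrCA kappa alpha (ell * _)).
  rewrite lerD//; apply: ler_wpM2l; rewrite ?(ltW alpha_gt0)// distrC.
    by rewrite IH// ltnW.
  apply: (le_trans (T_lip (x m, x n) _)) => //=.
  rewrite (mulrCA kappa ell (c _ _ _ _)).
  by rewrite ler_wpM2l ?(ltW ell_gt0)// xTx// ltnW.
move=> m n mn; split; first exact: xTx (main m) _ mn.
(* On the diagonal [e m m] reduces to [c alpha ell m m.+1 / alpha]. *)
by rewrite (le_trans (main m m (leqnn m)))// /e cmm mulr0 subr0 mulrA.
Qed.
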